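(* Let $\Theta\subset\mathbb{R}^d$ be open and, for $\theta\in\Theta$ and $\varepsilon>0$, let $Y_\varepsilon(t)$, $t\in[0,1)$, be observed, where $$dY_\varepsilon(t)=S(t,\theta)\,dt+\varepsilon\,dw(t),$$ with $S(\cdot,\theta)\in\mathbb{L}_2(0,1)$ and $dw(t)$ Gaussian white noise. Let $u_\varepsilon>0$, $\varepsilon>0$, be a family with $u_\varepsilon\to0$ and $\varepsilon^{-1}u_\varepsilon\to\infty$ as $\varepsilon\to0$. Suppose the statistical experiment has finite Fisher information for all $\theta\in\Theta$, with Fisher information matrix $I(\theta)$, and let $\hat\theta_\varepsilon$ be a $u_\varepsilon$-consistent estimator of $\theta$. Then for any $\theta\in\Theta$ and any open set $V\subset\mathbb{R}^d$, $$\liminf_{\varepsilon\to0}\varepsilon^2u_\varepsilon^{-2}\log\mathbf{P}_\theta\bigl(\hat\theta_\varepsilon-\theta\in u_\varepsilon V\bigr)\ge-\frac12\inf_{\tau\in V}\tau^TI(\theta)\tau .$$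
   Context: $\mathbf{P}_\theta$ denotes the law of the observed process $Y_\varepsilon$ when the parameter is $\theta$; $\hat\theta_\varepsilon$ is a measurable function of the observed path. Finite Fisher information at $\theta_0\in\Theta$: there is a vector function $S_\theta(\cdot,\theta_0):[0,1)\to\mathbb{R}^d$ (the $\mathbb{L}_2(0,1)$-derivative of the signal in $\theta$ at $\theta_0$) such that $$\int_0^1\bigl(S(t,\theta)-S(t,\theta_0)-S_\theta^T(t,\theta_0)(\theta-\theta_0)\bigr)^2dt=o(|\theta-\theta_0|^2)\quad\text{as }\theta\to\theta_0,$$ and the Fisher information matrix $I(\theta_0)=\int_0^1S_\theta(t,\theta_0)S_\theta^T(t,\theta_0)\,dt$ is positive definite. $u_\varepsilon$-consistency: every $\theta_0\in\Theta$ has a neighborhood $U$ such that for every $\delta>0$, $\lim_{\varepsilon\to0}\sup_{\theta\in U}\mathbf{P}_\theta(|\hat\theta_\varepsilon-\theta|>\delta u_\varepsilon)=0$. Conventions: $u_\varepsilon V=\{u_\varepsilon\tau:\tau\in V\}$, $\log0=-\infty$. *)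

(* Defs.v *)
From HB Require Import structures.
From mathcomp Require Import all_boot all_order all_algebra.
From mathcomp Require Import all_classical all_reals all_analysis.

Set Implicit Arguments.
Unset Strict Implicit.
Unset Printing Implicit Defensive.

Import Order.TTheory GRing.Theory Num.Theory.
Import numFieldNormedType.Exports.

Local Open Scope classical_set_scope.
Local Open Scope ring_scope.

Section linear_algebra.
Context {R : realType} {d : nat}.
Implicit Types (x : 'cV[R]_d) (A : 'M[R]_d).

(* The library norm of ['cV[R]_d] is the max norm; this is the Euclidean one. *)
Definition enorm x : R := Num.sqrt (\sum_(i < d) x i 0 ^+ 2).

Definition quadform A x : R := (x^T *m A *m x) 0 0.

Definition posdef A : Prop := forall x, x != 0 -> 0 < quadform A x.

(* Borel sigma-algebra of R^d; its open sets are the usual ones. *)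
Definition borel_cV : measurableType _ := g_sigma_algebraType (@open 'cV[R]_d).

End linear_algebra.
Arguments borel_cV : clear implicits.

Section square_integrable.
Context {R : realType}.

Definition L2 (f : R -> R) : Prop :=
  f \_ `[0, 1[ \in Lfun (@lebesgue_measure R) 2%:E.

End square_integrable.

Section wiener_process.
Context {R : realType} {disp : measure_display} {T : measurableType disp}.
Variable P : probability T R.

(* Some of the [B i] may be [setT], so subfamilies are covered. *)
Definition mutually_independent (n : nat) (X : 'I_n -> T -> R) : Prop :=
  forall B : 'I_n -> set R, (forall i, measurable (B i)) ->
    P (\bigcap_(i in [set: 'I_n]) (X i @^-1` B i))
    = (\prod_(i < n) P (X i @^-1` B i))%E.

(* Standard Wiener process on the time interval [0, 1): [w t] is its value at
   time [t]; values at times outside [0, 1) are unconstrained. *)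
Record wiener_process (w : R -> T -> R) : Prop := WienerProcess {
  wiener_measurable : forall t : R, 0 <= t < 1 -> measurable_fun [set: T] (w t) ;
  wiener_start : {ae P, forall x, w 0 x = 0} ;
  wiener_continuous : {ae P, forall x, {within `[0, 1[, continuous (w ^~ x)}} ;
  wiener_gaussian : forall s t : R, 0 <= s -> s < t -> t < 1 ->
    forall B, measurable B ->
      P ((fun x => w t x - w s x) @^-1` B)
      = normal_prob 0 (Num.sqrt (t - s)) B ;
  wiener_independent : forall (n : nat) (t : nat -> R),
    (forall i, (i <= n)%N -> 0 <= t i < 1) ->
    (forall i, (i < n)%N -> t i < t i.+1) ->
    mutually_independent (fun (i : 'I_n) x => w (t i.+1) x - w (t i) x)
}.

End wiener_process.

Section path_space.
Variable R : realType.

(* A path is a function of time; the sigma-algebra is generated by the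
   evaluations at times in [0, 1) only, so a measurable function of the path
   depends on its restriction to [0, 1). *)
Definition path_space : measurableType _ :=
  g_sigma_algebraType
    (\bigcup_(t in `[0, 1[)
       preimage_set_system [set: R -> R] (fun y : R -> R => y t) measurable).

End path_space.

Section experiment.
Context {R : realType} {d : nat} {disp : measure_display}
  {T : measurableType disp}.
Variables (P : probability T R) (w : R -> T -> R).
Variable S : 'cV[R]_d -> R -> R.

(* Y(t) = int_0^t S(s, theta) ds + eps * w(t) *)
Definition observation (eps : R) (theta : 'cV[R]_d) (x : T) : path_space R :=
  fun t => \int[lebesgue_measure]_(s in `[0, t]) S theta s + eps * w t x.

Definition law (eps : R) (theta : 'cV[R]_d) : set (path_space R) -> \bar R :=
  pushforward P (observation eps theta).

End experiment.

Section fisher_information.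
Context {R : realType} {d : nat}.
Implicit Types (S : 'cV[R]_d -> R -> R) (Sdot : R -> 'cV[R]_d).

Definition fisher_matrix Sdot : 'M[R]_d :=
  \matrix_(i, j) \int[lebesgue_measure]_(t in `[0, 1[) (Sdot t *m (Sdot t)^T) i j.

(* [Sdot] plays the role of S_theta(., theta0). *)
Definition finite_fisher S (theta0 : 'cV[R]_d) Sdot : Prop :=
  [/\ forall i, L2 (fun t => Sdot t i 0),
      (fun theta : 'cV[R]_d => \int[lebesgue_measure]_(t in `[0, 1[)
         (S theta t - S theta0 t - ((Sdot t)^T *m (theta - theta0)) 0 0) ^+ 2
         : R^o)
      =o_ (nbhs theta0) (fun theta => enorm (theta - theta0) ^+ 2 : R^o) &
      posdef (fisher_matrix Sdot)].

End fisher_information.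

Section estimation.
Context {R : realType} {d : nat}.

Definition estimator (est : R -> path_space R -> 'cV[R]_d) : Prop :=
  forall eps : R, 0 < eps ->
    measurable_fun [set: path_space R] (est eps : _ -> borel_cV R d).

Definition consistent (Theta : set 'cV[R]_d)
    (Prob : R -> 'cV[R]_d -> set (path_space R) -> \bar R) (u : R -> R)
    (est : R -> path_space R -> 'cV[R]_d) : Prop :=
  forall theta0, Theta theta0 -> exists U : set 'cV[R]_d,
    [/\ nbhs theta0 U, U `<=` Theta &
      forall delta : R, 0 < delta ->
        ereal_sup [set Prob eps theta
                     [set y | delta * u eps < enorm (est eps y - theta)]
                  | theta in U] @[eps --> 0^'+] --> 0%E].

End estimation.

(* Main.v *)
Require Import Defs.
From HB Require Import structures.
From mathcomp Require Import all_boot all_order all_algebra.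
From mathcomp Require Import all_classical all_reals all_analysis.
From mathcomp Require Import measurable_realfun ring lra.

(* Fix [tau] in [V] and compare [P_theta] with [P_theta'], where
   [theta' = theta + u_eps tau].  By consistency the event
   [est - theta \in u_eps V] has [P_theta']-probability close to 1.  Writing
   [L = dP_theta'/dP_theta], a Gaussian density, and [a^2 = |h|^2 / eps^2] with
   [h = S theta' - S theta], the pointwise bound [L <= e^k + e^(-(q-1)k) L^q] for
   [q > 1] and [E L^q = exp (q (q-1) a^2 / 2)] give
   [P_theta' A <= e^k P_theta A + exp ((q - 1) (q a^2 / 2 - k))].
   With [k] slightly above [q a^2 / 2] the last term tends to 0, so that
   [log P_theta A >= - q a^2 / 2 (1 + o(1))]; the Fisher information yields
   [a^2 <= (u_eps / eps)^2 (tau^T I tau + o(1))], and [q] tends to 1.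
   The inequality between [P_theta' A] and [P_theta A] needs no stochastic
   integral: for sets depending on finitely many times, [L] is an explicit product
   of densities of independent increments and the energy of the shift is at most
   [a^2] by Cauchy-Schwarz; the inequality is preserved by monotone limits of
   sets, so the monotone class theorem extends it to the path sigma-algebra. *)

Set Implicit Arguments.
Unset Strict Implicit.
Unset Printing Implicit Defensive.

Import Order.TTheory GRing.Theory Num.Theory.
Import numFieldNormedType.Exports.

Local Open Scope classical_set_scope.
Local Open Scope ring_scope.

(** * Gaussian densities *)

Section integration.
Context d (T : measurableType d) d' (Y : measurableType d') (R : realType).
Variables (mu : {measure set T -> \bar R}) (rho : {measure set Y -> \bar R}).
Import HBNNSimple.

(** The hypothesis says that [rho] is the image under [X] of the measure with density [G] with
    respect to [mu]. The identity passes from indicators to simple functions by linearity, then to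
    nonnegative functions by monotone convergence. *)
Lemma ge0_integral_law_density (X : T -> Y) (G : T -> R) :
  measurable_fun [set: T] X -> measurable_fun [set: T] G ->
  (forall x, 0 <= G x) ->
  (forall B, measurable B ->
     \int[mu]_(x in X @^-1` B) (G x)%:E = rho B)%E ->
  forall f : Y -> \bar R, measurable_fun [set: Y] f -> (forall y, 0 <= f y)%E ->
  (\int[mu]_x (f (X x) * (G x)%:E) = \int[rho]_y f y)%E.
Proof.
move=> mX mG G0 hG f mf f0.
have mXB B : measurable B -> measurable (X @^-1` B).
  by move=> mB; rewrite -[_ @^-1` _]setTI; exact: mX.
pose f_ := nnsfun_approx measurableT mf.
have mfX n : measurable_fun [set: T] (fun x => (f_ n (X x))%:E).
  by apply/measurable_EFinP; apply: measurableT_comp.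
transitivity (limn (fun n => \int[mu]_x ((f_ n (X x))%:E * (G x)%:E))%E).
  rewrite -monotone_convergence//=.
  - apply: eq_integral => x _; apply/esym/cvg_lim => //.
    by apply: cvgeZr => //; exact: cvg_nnsfun_approx.
  - by move=> n; apply: emeasurable_funM => //; exact/measurable_EFinP.
  - by move=> n x _; rewrite mule_ge0// lee_fin.
  - move=> x _ m n mn; rewrite lee_wpmul2r ?lee_fin//.
    exact/lefP/nd_nnsfun_approx.
transitivity (limn (fun n => \int[rho]_y (f_ n y)%:E)%E); last first.
  rewrite -monotone_convergence//.
  - apply: eq_integral => y _; apply/cvg_lim => //.
    exact: cvg_nnsfun_approx.
  - by move=> n; exact/measurable_EFinP/measurable_funP.
  - by move=> n y _; rewrite lee_fin.
  - by move=> y _ m n mn; rewrite lee_fin; exact/lefP/nd_nnsfun_approx.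
apply: congr_lim; apply/funext => n.
transitivity (\sum_(k \in range (f_ n))
    \int[mu]_x ((k * \1_(f_ n @^-1` [set k]) (X x))%:E * (G x)%:E))%E.
  rewrite -ge0_integral_fsum//=; last first.
  - move=> r x _.
    by apply: mule_ge0; rewrite ?EFinM ?nnfun_muleindic_ge0 ?lee_fin.
  - move=> r; apply: emeasurable_funM => //; last exact/measurable_EFinP.
    apply/measurable_EFinP; apply: measurable_funM => //.
    by apply: measurableT_comp.
  apply: eq_integral => x _.
  rewrite fimfunE -fsumEFin// ge0_mule_fsuml// => r.
  by rewrite nnfun_muleindic_ge0.
rewrite [RHS](_ : _ = \sum_(k \in range (f_ n)) 
  (\int[rho]_y (k * \1_(f_ n @^-1` [set k]) y)%:E))%E; last first.
  rewrite -ge0_integral_fsum//.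
  - by apply: eq_integral => y _; rewrite fimfunE -fsumEFin.
  - by move=> r; exact/measurable_EFinP/measurable_funM.
  - by move=> r y _; rewrite nnfun_muleindic_ge0.
(* Writing the level as a value [f_ n y] makes it nonnegative, so that it can be pulled out of both
   integrals. *)
apply: eq_fsbigr => r; rewrite inE => -[y _ <-].
have r0 : 0 <= f_ n y by [].
rewrite integralZl_indic_nnsfun// integral_indic// setIT.
under eq_integral do rewrite EFinM -muleA.
rewrite ge0_integralZl//; last first.
- by move=> x _; rewrite mule_ge0// lee_fin.
- apply: emeasurable_funM => //; apply/measurable_EFinP => //.
  by apply: measurableT_comp.
congr (_ * _)%E; rewrite -hG//.
rewrite [RHS]integral_mkcond; apply: eq_integral => x _.
rewrite patchE indicE.
rewrite -(_ : (X x \in f_ n @^-1` [set f_ n y]) =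
  (x \in X @^-1` (f_ n @^-1` [set f_ n y]))); last first.
  by apply/idP/idP; rewrite !inE.
by case: ifPn => _; rewrite ?mul1e ?mul0e.
Qed.

End integration.

Section normal.
Context {R : realType}.
Local Notation mu := (@lebesgue_measure R).

(** By uniqueness of Lebesgue measure it is enough to compare both measures on half-open
    intervals. *)
Lemma lebesgue_measure_shift (a : R) (A : set R) : measurable A ->
  pushforward mu (fun x : measurableTypeR R => x + a : measurableTypeR R) A =
  mu A.
Proof.
have ma : measurable_fun [set: measurableTypeR R]
    (fun x : measurableTypeR R => x + a : measurableTypeR R).
  exact: measurable_funD.
move=> mA; apply/esym/lebesgue_measure_unique => //= _ [[b c]] _ <-.
rewrite /pushforward/= (_ : _ @^-1` _ = `]b - a, c - a]%classic).
  rewrite !lebesgue_measure_itv/= !lte_fin ltrD2r.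
  by case: ifPn => // _; rewrite -!EFinB; congr (_%:E); ring.
by apply/seteqP; split => x /=; rewrite !in_itv/= ltrBlDr lerBrDr.
Qed.

Lemma normal_prob_shift (a s : R) (B : set R) : s != 0 -> measurable B ->
  normal_prob 0 s ((fun x => x + a) @^-1` B) = normal_prob a s B.
Proof.
move=> s0 mB; rewrite /normal_prob.
pose f (x : R) := (normal_pdf a s x)%:E.
transitivity (\int[pushforward mu (fun x : measurableTypeR R => (x + a)%R
   : measurableTypeR R)]_(x in B) f x)%E; last first.
  apply: eq_measure_integral => /=; first exact: measurable_funD.
  by move=> ? A mA _; exact: lebesgue_measure_shift.
rewrite ge0_integral_pushforward//=.
- apply: eq_integral => x _ /=; congr (_%:E).
  rewrite !normal_pdfE// /normal_fun.
  by rewrite subr0 addrK.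
- exact: measurable_funD.
- apply/measurable_EFinP; apply: measurable_funTS.
  exact: measurable_normal_pdf.
- by move=> y _; rewrite lee_fin normal_pdf_ge0.
Qed.

(* Density of N(a, s^2) with respect to N(0, s^2). *)
Definition gauss_tilt (a s x : R) : R :=
  expR (a * x / s ^+ 2 - a ^+ 2 / (2 * s ^+ 2)).

Lemma measurable_gauss_tilt (a s : R) :
  measurable_fun [set: R] (gauss_tilt a s).
Proof.
apply: measurableT_comp => //; apply: measurable_funB => //.
by apply: measurable_funM => //; apply: measurable_funM.
Qed.

Lemma integral_gauss_tilt (a s : R) (B : set R) : s != 0 -> measurable B ->
  (\int[normal_prob 0 s]_(x in B) (gauss_tilt a s x)%:E = normal_prob a s B)%E.
Proof.
move=> s0 mB.
have mt : measurable_fun B (fun x => (gauss_tilt a s x)%:E).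
  by apply/measurable_EFinP/measurable_funTS; exact: measurable_gauss_tilt.
rewrite integral_mkcond.
(* With [X] the identity and [G] the normal density, an integral against [normal_prob 0 s] becomes a
   Lebesgue integral; the exponents then agree by completing the square. *)
rewrite -(@ge0_integral_law_density _ _ _ _ _ mu (normal_prob 0 s) idfun
  (normal_pdf 0 s)) //=.
- rewrite /normal_prob [RHS]integral_mkcond; apply: eq_integral => x _.
  rewrite !patchE; case: ifPn => _; rewrite ?mul0e// -EFinM; congr (_%:E).
  rewrite !normal_pdfE// mulrCA -expRD; congr (_ * expR _).
  field; exact: s0.
- exact: measurable_id.
- exact: measurable_normal_pdf.
- by move=> x; exact: normal_pdf_ge0.
- exact/(measurable_restrictT _ _).1.
- by move=> x; rewrite patchE; case: ifPn => // _; rewrite lee_fin expR_ge0.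
Qed.
End normal.

(** Inductive step for inserting the densities: [G] collects the weights of the other coordinates
    and [c] their total contribution, and one more tilt moves the mean of [X] from 0 to [a]. *)
Lemma integral_gauss_tilt_law d (T : measurableType d) (R : realType)
    (P : {measure set T -> \bar R}) (X : T -> R) (G : T -> R) (c a s : R) :
  measurable_fun [set: T] X -> measurable_fun [set: T] G ->
  (forall x, 0 <= G x) -> 0 <= c -> s != 0 ->
  (forall B, measurable B ->
     \int[P]_(x in X @^-1` B) (G x)%:E = c%:E * normal_prob 0 s B)%E ->
  forall B, measurable B ->
  (\int[P]_(x in X @^-1` B) (gauss_tilt a s (X x) * G x)%:E
    = c%:E * normal_prob a s B)%E.
Proof.
move=> mX mG G0 c0 s0 hG B mB.
have mt : measurable_fun B (fun x => (gauss_tilt a s x)%:E).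
  by apply/measurable_EFinP/measurable_funTS; exact: measurable_gauss_tilt.
pose rho := mscale (NngNum c0) (normal_prob 0 s).
rewrite -integral_gauss_tilt//.
have t0 x : B x -> (0 <= (gauss_tilt a s x)%:E)%E by rewrite lee_fin expR_ge0.
rewrite -[c]/((NngNum c0)%:num) -ge0_integral_mscale//.
rewrite integral_mkcond [RHS]integral_mkcond.
rewrite -(@ge0_integral_law_density _ _ _ _ _ P
  (mscale (NngNum c0) (normal_prob 0 s)) X G) //=.
- apply: eq_integral => x _; rewrite !patchE.
  rewrite (_ : (x \in _) = (X x \in B)); last by apply/idP/idP; rewrite !inE.
  by case: ifPn => _; rewrite ?mul0e// EFinM.
- exact/(measurable_restrictT _ _).1.
- by move=> x; rewrite patchE; case: ifPn => // _; rewrite lee_fin expR_ge0.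
Qed.

(** * Density of a shifted vector of independent Gaussians *)

Section gauss_density.
Context d (T : measurableType d) (R : realType) (P : probability T R).
Variables (n : nat) (X : 'I_n -> T -> R) (a s : 'I_n -> R).
Hypothesis mX : forall i, measurable_fun [set: T] (X i).
Hypothesis s0 : forall i, s i != 0.
Hypothesis indX : mutually_independent P X.
Hypothesis lawX : forall i B, measurable B ->
  P (X i @^-1` B) = normal_prob 0 (s i) B.

Let mXB i (B : set R) : measurable B -> measurable (X i @^-1` B).
Proof. by move=> mB; rewrite -[_ @^-1` _]setTI; exact: mX. Qed.

Lemma measurable_prod_tilt (p : pred 'I_n) :
  measurable_fun [set: T]
    (fun x => \prod_(i < n | p i) gauss_tilt (a i) (s i) (X i x)).
Proof.
elim: (index_enum _) => [|i r IH].
  by under eq_fun do rewrite big_nil; exact: measurable_cst.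
under eq_fun do rewrite big_cons; case: (p i) => //.
apply: measurable_funM => //; apply: measurableT_comp => //.
exact: measurable_gauss_tilt.
Qed.

(* The densities are inserted one coordinate at a time. *)
Let partial_tilt m : (m <= n)%N -> forall B : 'I_n -> set R,
  (forall i, measurable (B i)) ->
  (\int[P]_(x in \bigcap_(i in [set: 'I_n]) (X i @^-1` B i))
     (\prod_(i < n | (i < m)%N) gauss_tilt (a i) (s i) (X i x))%:E
   = \prod_(i < n) normal_prob (if (i < m)%N then a i else 0%R) (s i) (B i))%E.
Proof.
elim: m => [|m IH] mn B mB.
  under eq_integral do rewrite big_pred0//.
  rewrite integral_cst; last first.
    apply: fin_bigcap_measurable => // i _; exact: mXB.
  rewrite mul1e; apply: (eq_trans (indX mB)).
  by apply: eq_bigr => i _; exact: lawX.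
pose j := Ordinal mn.
pose E := \bigcap_(i in [set i | i != j]) (X i @^-1` B i).
pose g x := \prod_(i < n | (i < m)%N) gauss_tilt (a i) (s i) (X i x).
have mE : measurable E.
  by apply: fin_bigcap_measurable => [|i _]; [exact: finite_finset|exact: mXB].
have g0 x : 0 <= g x by apply: prodr_ge0 => i _; exact: expR_ge0.
have cE : (\prod_(i < n | i != j)
    normal_prob (if (i < m)%N then a i else 0%R) (s i) (B i))%E \is a fin_num.
  apply: prode_fin_num => i _; apply: fin_num_measure; exact: mB.
(* [B0] is left free because the induction hypothesis, in which coordinate [j] is still untilted,
   has to identify the law of [X j] under the weight [g * \1_E] on every Borel set. *)
have split_j (h : T -> R) (B0 : set R) :
    (\int[P]_(x in \bigcap_(i in [set: 'I_n])
        (X i @^-1` (if i == j then B0 else B i))) (h x)%:E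
     = \int[P]_(x in X j @^-1` B0) (h x * \1_E x)%:E)%E.
  rewrite integral_mkcond [RHS]integral_mkcond; apply: eq_integral => x _.
  rewrite !patchE indicE.
  have -> : (x \in \bigcap_(i in [set: 'I_n])
        (X i @^-1` (if i == j then B0 else B i)))
     = (x \in X j @^-1` B0) && (x \in E).
    apply/idP/andP; rewrite !inE.
    - move=> H; split; first by have := H j I; rewrite eqxx.
      by move=> i /= /negbTE ij; have := H i I; rewrite ij.
    - move=> [H1 H2] i _ /=; case: eqVneq => [->//|ij]; exact: H2.
  case: (x \in X j @^-1` B0) => //=.
  by case: (x \in E); rewrite ?mulr1 ?mulr0.
have BE : B = fun i => if i == j then B j else B i.
  by apply/funext => i; case: eqVneq => // ->.
rewrite [in LHS]BE split_j.
transitivity (\int[P]_(x in X j @^-1` B j)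
   (gauss_tilt (a j) (s j) (X j x) * (g x * \1_E x))%:E)%E.
  apply: eq_integral => x _; rewrite mulrA; congr (_ * _)%:E.
  rewrite (bigD1 j)//=; congr (_ * _); apply: eq_bigl => i.
  by rewrite ltnS [RHS]ltn_neqAle -val_eqE/= andbC.
rewrite (@integral_gauss_tilt_law _ _ _ P (X j) _ (fine
  (\prod_(i < n | i != j)
     normal_prob (if (i < m)%N then a i else 0%R) (s i) (B i))%E))//.
- rewrite fineK// [RHS](bigD1 j)//= ltnSn muleC; congr (_ * _)%E.
  apply: eq_bigr => i ij; rewrite ltnS [in RHS]leq_eqVlt.
  by rewrite -val_eqE/= in ij; rewrite (negbTE ij).
- apply: measurable_funM => //; exact: measurable_prod_tilt.
- by move=> x; rewrite mulr_ge0.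
- by apply: fine_ge0; apply: prode_ge0 => i _; exact: measure_ge0.
- move=> B0 mB0; rewrite -split_j IH; last 2 first.
  + exact: ltnW.
  + by move=> i; case: ifP.
  rewrite fineK// (bigD1 j)//= eqxx ltnn muleC; congr (_ * _)%E.
  by apply: eq_bigr => i /negbTE ->.
Qed.

(** Both sides equal the product of the [N(a i, s i ^ 2)]-masses of the [B i]: the left one after
    all [n] tilts are inserted, the right one by independence and translation. *)
Lemma gauss_shift_density (B : 'I_n -> set R) : (forall i, measurable (B i)) ->
  (\int[P]_(x in \bigcap_(i in [set: 'I_n]) (X i @^-1` B i))
     (\prod_(i < n) gauss_tilt (a i) (s i) (X i x))%:E
   = P (\bigcap_(i in [set: 'I_n]) ((fun x => (X i x + a i)%R) @^-1` B i)))%E.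
Proof.
move=> mB.
transitivity (\int[P]_(x in \bigcap_(i in [set: 'I_n]) (X i @^-1` B i))
     (\prod_(i < n | (i < n)%N) gauss_tilt (a i) (s i) (X i x))%:E)%E.
  apply: eq_integral => x _; congr (_%:E).
  by apply: eq_bigl => i; rewrite ltn_ord.
have mBa i : measurable ((fun y => y + a i) @^-1` B i).
  rewrite -[_ @^-1` _]setTI.
  apply: (_ : measurable_fun [set: R] (fun y => y + a i)) => //.
  exact: measurable_funD.
rewrite partial_tilt//; apply/esym/(eq_trans (indX mBa)).
by apply: eq_bigr => i _; rewrite ltn_ord -normal_prob_shift//; exact: lawX.
Qed.

End gauss_density.

Section tilt_integral.
Context d (T : measurableType d) (R : realType) (P : probability T R).
Variables (n : nat) (X : 'I_n -> T -> R) (a s : 'I_n -> R).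
Hypothesis mX : forall i, measurable_fun [set: T] (X i).
Hypothesis s0 : forall i, s i != 0.
Hypothesis indX : mutually_independent P X.
Hypothesis lawX : forall i B, measurable B ->
  P (X i @^-1` B) = normal_prob 0 (s i) B.

Lemma integral_prod_tilt :
  (\int[P]_x (\prod_(i < n) gauss_tilt (a i) (s i) (X i x))%:E = 1)%E.
Proof.
have := gauss_shift_density a mX s0 indX lawX (B := fun=> setT)
  (fun=> measurableT).
have -> : \bigcap_(i in [set: 'I_n]) (X i @^-1` [set: R]) = [set: T].
  by apply/seteqP; split.
by move=> ->; rewrite -[RHS](@probability_setT _ _ _ P); congr (P _).
Qed.

End tilt_integral.

Section tilt_bound.
Context d (T : measurableType d) (R : realType) (P : probability T R).
Variables (n : nat) (X : 'I_n -> T -> R) (a s : 'I_n -> R).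
Hypothesis mX : forall i, measurable_fun [set: T] (X i).
Hypothesis s0 : forall i, s i != 0.
Hypothesis indX : mutually_independent P X.
Hypothesis lawX : forall i B, measurable B ->
  P (X i @^-1` B) = normal_prob 0 (s i) B.

(* With [L] the density, [L <= e^k + e^(-(q-1)k) L^q], and [L^q] is up to a
   constant the density for the shift [q a]. *)
Lemma integral_prod_tilt_le (N k q : R) (E : set T) :
  \sum_(i < n) a i ^+ 2 / s i ^+ 2 <= N -> 1 <= q -> measurable E ->
  (\int[P]_(x in E) (\prod_(i < n) gauss_tilt (a i) (s i) (X i x))%:E
   <= (expR k)%:E * P E + (expR ((q - 1) * (q * N / 2 - k)))%:E)%E.
Proof.
move=> aN q1 mE.
set A := \sum_(i < n) _ in aN.
pose l x := \sum_(i < n) (a i * X i x / s i ^+ 2).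
have tiltE (b : 'I_n -> R) x : \prod_(i < n) gauss_tilt (b i) (s i) (X i x) =
    expR (\sum_(i < n) (b i * X i x / s i ^+ 2 - b i ^+ 2 / (2 * s i ^+ 2))).
  by rewrite (big_morph _ (@expRD R) (@expR0 R)).
have LE x : \prod_(i < n) gauss_tilt (a i) (s i) (X i x) = expR (l x - A / 2).
  rewrite tiltE sumrB; congr (expR (_ - _)); rewrite mulr_suml.
  by apply: eq_bigr => i _; field; exact: s0.
have LqE x : \prod_(i < n) gauss_tilt (q * a i) (s i) (X i x) =
    expR (q * l x - q ^+ 2 * A / 2).
  rewrite tiltE sumrB /l mulr_sumr /A mulr_sumr mulr_suml.
  by congr (expR (_ - _)); apply: eq_bigr => i _; field; exact: s0.
(* [L^q] is [exp (q (q - 1) A / 2)] times the density for the shift [q a]; [eta] is this factor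
   times [e^(-(q-1)k)]. *)
pose eta := expR ((q - 1) * (q * A / 2 - k)).
have mL (b : 'I_n -> R) (D : set T) : measurable_fun D
    (fun x => (\prod_(i < n) gauss_tilt (b i) (s i) (X i x))%:E).
  apply: measurable_funTS; apply/measurable_EFinP.
  exact: (measurable_prod_tilt b s mX xpredT).
have L0 (b : 'I_n -> R) x : 0 <= \prod_(i < n) gauss_tilt (b i) (s i) (X i x).
  by apply: prodr_ge0 => i _; exact: expR_ge0.
pose Lq x := \prod_(i < n) gauss_tilt (q * a i) (s i) (X i x).
apply: (@le_trans _ _ (\int[P]_(x in E) ((expR k)%:E + eta%:E * (Lq x)%:E))%E).
  apply: ge0_le_integral => //.
  - by move=> x _; rewrite lee_fin.
  - by apply: emeasurable_funD => //; apply: emeasurable_funM => //; exact: mL.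
  - move=> x _; rewrite lee_fin LE /Lq LqE /eta -expRD.
    (* If [L <= e^k] the first term suffices. Otherwise the logarithm of the second term exceeds
       that of [L] by [(q - 1) (l x - A / 2 - k)], which is nonnegative. *)
    have [lk|kl] := leP (l x - A / 2) k.
      by rewrite (le_trans (_ : _ <= expR k)) ?ler_expR// lerDl expR_ge0.
    rewrite (le_trans (_ : _ <= expR ((q - 1) * (q * A / 2 - k) +
       (q * l x - q ^+ 2 * A / 2)))) ?lerDr ?expR_ge0// ler_expR.
    rewrite -subr_ge0 (_ : _ - _ = (q - 1) * (l x - A / 2 - k)); last by field.
    by rewrite mulr_ge0// subr_ge0// ltW.
rewrite ge0_integralD//; last first.
- by apply: emeasurable_funM => //; exact: mL.
- move=> x _; apply: mule_ge0; rewrite lee_fin ?expR_ge0//; exact: L0.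
rewrite integral_cst// leeD2l// ge0_integralZl//; last first.
- exact: expR_ge0.
- by move=> x _; exact: L0.
- exact: mL.
(* [Lq] is itself a probability density, so its integral over [E] is at most 1; afterwards [A] is
   replaced by its bound [N]. *)
apply: (@le_trans _ _ eta%:E).
  rewrite -[leRHS]mule1 lee_wpmul2l ?lee_fin ?expR_ge0//.
  rewrite -(integral_prod_tilt (fun i => q * a i) mX s0 indX lawX).
  apply: ge0_subset_integral => //; first exact: mL.
  by move=> x _; exact: L0.
rewrite lee_fin ler_expR ler_wpM2l ?subr_ge0// lerB// ler_wpM2r// ler_wpM2l//.
by rewrite (le_trans _ q1).
Qed.

End tilt_bound.

(** * Cameron-Martin inequality on the path space *)

(** An inequality of this kind is not stable under complements, so a monotone class replaces a
    Dynkin system. Along increasing sets the bound for the union dominates every term; along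
    decreasing sets both sides converge, [m2] being finite. *)
Lemma monotone_le_affine d (T : measurableType d) (R : realType)
    (m1 m2 : probability T R) (c e : R) : 0 <= c ->
  monotone [set A | measurable A /\ (m1 A <= c%:E * m2 A + e%:E)%E].
Proof.
move=> c0; split=> F mon HF.
- have mF i : measurable (F i) by have [] := HF i.
  have mU : measurable (\bigcup_i F i) by exact: bigcupT_measurable.
  split => //.
  have := nondecreasing_cvg_mu mF mU mon => /(_ _ m1) cv.
  apply: (cvge_to_le cv); apply: nearW => n /=.
  apply: (le_trans (HF n).2); rewrite leeD2r// lee_wpmul2l// ?lee_fin//.
  by apply: le_measure; rewrite ?inE//; exact: bigcup_sup.
- have mF i : measurable (F i) by have [] := HF i.
  have mI : measurable (\bigcap_i F i) by exact: bigcapT_measurable.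
  split => //.
  have fin : (m2 (F 0%N) < +oo)%E by rewrite ltey_eq fin_num_measure.
  have cv2 := nonincreasing_cvg_mu fin mF mI mon.
  have cv : (c%:E * m2 (F n) + e%:E)%E @[n --> \oo]
      --> (c%:E * m2 (\bigcap_i F i) + e%:E)%E.
    apply: cvgeD; [|exact: cvgeZl|exact: cvg_cst].
    by rewrite fin_num_adde_defl.
  apply: (cvge_to_ge cv); apply: nearW => n /=.
  apply: le_trans (HF n).2.
  by apply: le_measure; rewrite ?inE//; exact: bigcap_inf.
Qed.

(** * Path sigma-algebra and cylinder sets *)

Section evaluations.
Context {R : realType}.

(** For [I] equal to [[0, 1[] this is the generating family of [path_space]; a finite [I] yields the
    events decided by finitely many times. *)
Definition evaluations (I : set R) : set_system (R -> R) :=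
  \bigcup_(t in I) preimage_set_system [set: R -> R] (fun y => y t) measurable.

Lemma measurable_evaluation (I : set R) t : I t ->
  measurable_fun [set: g_sigma_algebraType (evaluations I)]
    (fun y : g_sigma_algebraType (evaluations I) => y t).
Proof.
move=> It _ B mB; apply: sub_sigma_algebra; exists t => //; by exists B.
Qed.

Lemma measurable_path d (T : measurableType d) (I : set R)
    (f : T -> g_sigma_algebraType (evaluations I)) :
  (forall t, I t -> measurable_fun [set: T] (fun x => f x t)) ->
  measurable_fun [set: T] f.
Proof.
move=> mf; have := @measurability _ _ T (g_sigma_algebraType (evaluations I))
  setT f (evaluations I) erefl.
apply => _ [_ [t It [B mB <-]] <-].
by rewrite setTI; exact: mf.
Qed.

Lemma evaluations_sub (I J : set R) : I `<=` J ->
  <<s evaluations I >> `<=` <<s evaluations J >>.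
Proof.
move=> IJ; apply: smallest_sub; first exact: smallest_sigma_algebra.
by move=> A [t It HA]; apply: sub_sigma_algebra; exists t => //; exact: IJ.
Qed.

Definition cylinders (I : set R) : set_system (R -> R) :=
  [set A | exists2 ts : seq R,
     [set` ts] `<=` I & <<s evaluations [set` ts] >> A].

(** Two cylinders live over a common list of times, the concatenation of theirs, so unions and
    differences are formed in a single sigma-algebra. *)
Lemma setring_cylinders (I : set R) : setring (cylinders I).
Proof.
have sa (ts : seq R) : sigma_algebra setT <<s evaluations [set` ts] >>.
  exact: smallest_sigma_algebra.
have cyl2 A B : cylinders I A -> cylinders I B ->
    exists2 ts : seq R, [set` ts] `<=` I &
      <<s evaluations [set` ts] >> A /\ <<s evaluations [set` ts] >> B.
  move=> [t tI HA] [s sI HB]; exists (t ++ s).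
    by move=> x /=; rewrite mem_cat => /orP[/tI|/sI].
  split; [move: HA|move: HB]; apply: evaluations_sub => x /= xs;
    by rewrite mem_cat xs ?orbT.
split.
- by exists [::] => //; exact: (sigma_algebra0).
- move=> A B HA HB; have [ts tsI [mA mB]] := cyl2 _ _ HA HB; exists ts => //.
  exact: (@measurableU _ (g_sigma_algebraType (evaluations [set` ts]))).
- move=> A B HA HB; have [ts tsI [mA mB]] := cyl2 _ _ HA HB; exists ts => //.
  exact: (@measurableD _ (g_sigma_algebraType (evaluations [set` ts]))).
Qed.

(** Monotone class theorem for the ring of cylinders. The whole space is the cylinder over the empty
    list, so the generated sigma-ring is a sigma-algebra. *)
Lemma g_sigma_algebra_evaluations_sub (I : set R) (G : set_system (R -> R)) :
  monotone G -> cylinders I `<=` G -> <<s evaluations I >> `<=` G.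
Proof.
move=> mG cG.
apply: subset_trans
  (monotone_setring_sub_g_sigma_ring mG (setring_cylinders I) cG).
have [sr0 srD srU] : sigma_ring <<sr cylinders I >>.
  exact: smallest_sigma_ring.
have cylT : <<sr cylinders I >> setT.
  apply: sub_gen_smallest; exists [::] => //.
  exact: (@measurableT _ (g_sigma_algebraType (evaluations [set` [::]]))).
apply: smallest_sub; first by split => // A HA; exact: srD.
move=> A [t It [B mB <-]]; apply: sub_gen_smallest; exists [:: t].
  by move=> x /=; rewrite inE => /eqP ->.
apply: sub_sigma_algebra; exists t; first by rewrite /= inE.
by exists B.
Qed.

End evaluations.

(** * Shift of the process on a finite grid of times *)

Section grid.
Context d (T : measurableType d) (R : realType) (P : probability T R).
Variables (W : R -> T -> R) (D : R -> R) (n : nat) (t : nat -> R).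
Hypothesis mW : forall i, (i <= n)%N -> measurable_fun [set: T] (W (t i)).
Hypothesis W0 : forall x, W (t 0%N) x = 0.
Hypothesis D0 : D (t 0%N) = 0.
Hypothesis t_lt : forall i, (i < n)%N -> t i < t i.+1.

Let X (i : 'I_n) x := W (t i.+1) x - W (t i) x.
Let a (i : 'I_n) := D (t i.+1) - D (t i).
Let s (i : 'I_n) := Num.sqrt (t i.+1 - t i).

Hypothesis lawX : forall i B, measurable B ->
  P (X i @^-1` B) = normal_prob 0 (s i) B.
Hypothesis indX : mutually_independent P X.

Let mX i : measurable_fun [set: T] (X i).
Proof. by apply: measurable_funB; apply: mW => //; exact: ltnW. Qed.

Let s0 i : s i != 0.
Proof. by rewrite gt_eqF// sqrtr_gt0 subr_gt0 t_lt. Qed.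

(** Rectangles are taken in increments, which are independent. The starting value is recorded too,
    since increments alone do not determine the values on the grid. *)
Let rectangles : set_system (R -> R) :=
  [set A | exists (B0 : set R) (B : 'I_n -> set R),
    [/\ measurable B0, forall i, measurable (B i) &
     A = [set y : R -> R | B0 (y (t 0%N)) /\
                           forall i : 'I_n, B i (y (t i.+1) - y (t i))]]].

Let rectanglesI : setI_closed rectangles.
Proof.
move=> _ _ [B0 [B [mB0 mB ->]]] [C0 [C [mC0 mC ->]]].
exists (B0 `&` C0), (fun i => B i `&` C i); split.
- exact: measurableI.
- by move=> i; exact: measurableI.
- apply/seteqP; split=> y /=.
  + by move=> [[By0 By] [Cy0 Cy]]; split => // i; split.
  + by move=> [[By0 Cy0] BC]; split; split => // i; have [] := BC i.
Qed.

Let measurable_rect_eval j : (j <= n)%N ->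
  measurable_fun [set: g_sigma_algebraType rectangles]
    (fun y : g_sigma_algebraType rectangles => y (t j)).
Proof.
elim: j => [_|j IH jn].
  move=> _ B mB; rewrite setTI; apply: sub_sigma_algebra.
  exists B, (fun=> setT); split => //.
  by apply/seteqP; split=> y //= [].
rewrite (_ : (fun y => _) = (fun y : g_sigma_algebraType rectangles =>
   y (t j) + (y (t j.+1) - y (t j)))); last first.
  by apply/funext => y; rewrite subrKC.
apply: measurable_funD; first by apply: IH; exact: ltnW.
move=> _ B mB; rewrite setTI; apply: sub_sigma_algebra.
exists setT, (fun i => if i == Ordinal jn then B else setT); split => //.
  by move=> i; case: ifP.
apply/seteqP; split=> y /=.
  by move=> By; split => // i; case: eqVneq => // ->.
by move=> [_ /(_ (Ordinal jn))]; rewrite eqxx.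
Qed.

Let evaluations_sub_rectangles :
  <<s evaluations [set t i | i in `I_n.+1] >> `<=` <<s rectangles >>.
Proof.
apply: smallest_sub; first exact: smallest_sigma_algebra.
move=> _ [_ [j jn <-] [B mB <-]].
exact: (measurable_rect_eval jn measurableT mB).
Qed.

Let measurable_rect (f : T -> g_sigma_algebraType rectangles) :
  (forall j, (j <= n)%N -> measurable_fun [set: T] (fun x => f x (t j))) ->
  measurable_fun [set: T] f.
Proof.
move=> mf; have := @measurability _ _ T (g_sigma_algebraType rectangles)
  setT f rectangles erefl.
apply => _ [_ [B0 [B [mB0 mB ->]]] <-]; rewrite setTI.
rewrite (_ : _ @^-1` _ = ((fun x => f x (t 0%N)) @^-1` B0) `&`
   \bigcap_(i in [set: 'I_n]) ((fun x => f x (t i.+1) - f x (t i)) @^-1` B i)).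
  apply: measurableI.
    by rewrite -[_ @^-1` _]setTI; exact: mf.
  apply: fin_bigcap_measurable => // i _; rewrite -[_ @^-1` _]setTI.
  by apply: measurable_funB => //; apply: mf => //; exact: ltnW.
apply/seteqP; split=> x /=.
  by move=> [H1 H2]; split => // i _; exact: H2.
by move=> [H1 H2]; split => // i; exact: H2.
Qed.

Let L x := \prod_(i < n) gauss_tilt (a i) (s i) (X i x).

(** Both sides are probability measures in [A], because [L] has integral 1. They agree on
    rectangles, which are stable under intersection, hence on the generated sigma-algebra. *)
Let grid_law (A : set (R -> R)) : <<s rectangles >> A ->
  P ((fun x u => W u x + D u) @^-1` A) =
  (\int[P]_(x in (fun x u => W u x) @^-1` A) (L x)%:E)%E.
Proof.
set f : T -> g_sigma_algebraType rectangles := fun x u => W u x.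
set h : T -> g_sigma_algebraType rectangles := fun x u => W u x + D u.
have mf S : measurable S -> measurable (f @^-1` S).
  by move=> mS; rewrite -[_ @^-1` _]setTI; exact: measurable_rect mS.
have mh S : measurable S -> measurable (h @^-1` S).
  move=> mS; rewrite -[_ @^-1` _]setTI; apply: measurable_rect mS => // j jn.
  by apply: measurable_funD => //; exact: mW.
have L0 x : (0 <= (L x)%:E)%E.
  by rewrite lee_fin; apply: prodr_ge0 => i _; exact: expR_ge0.
have mL E : measurable_fun E (fun x => (L x)%:E).
  apply: measurable_funTS; apply/measurable_EFinP.
  exact: (measurable_prod_tilt a s mX xpredT).
have L1 : (\int[P]_x (L x)%:E = 1)%E := integral_prod_tilt a mX s0 indX lawX.
have lawC (FS HS : set T) : measurable FS -> measurable HS ->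
    P HS = (\int[P]_(x in FS) (L x)%:E)%E ->
    P (~` HS) = (\int[P]_(x in ~` FS) (L x)%:E)%E.
  move=> mFS mHS IH; rewrite probability_setC// IH -L1 -(setvU FS).
  rewrite ge0_integral_setU//=.
  + by rewrite addeK// -IH fin_num_measure.
  + exact: measurableC.
  + by apply/disj_setPS; rewrite setICl.
have lawU (FS HS : (set T)^nat) :
    (forall k, measurable (FS k)) -> (forall k, measurable (HS k)) ->
    trivIset setT FS -> trivIset setT HS ->
    (forall k, P (HS k) = (\int[P]_(x in FS k) (L x)%:E)%E) ->
    P (\bigcup_k HS k) = (\int[P]_(x in \bigcup_k FS k) (L x)%:E)%E.
  move=> mFS mHS tFS tHS IH; rewrite measure_semi_bigcup//; last first.
    exact: bigcupT_measurable.
  by rewrite ge0_integral_bigcup//=; apply: eq_eseriesr => i _; exact: IH.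
pose Q (S : set (g_sigma_algebraType rectangles)) :=
  P (h @^-1` S) = (\int[P]_(x in f @^-1` S) (L x)%:E)%E.
move: A; apply:
  (@dynkin_induction _ (g_sigma_algebraType rectangles) rectangles Q).
- by [].
- exact: rectanglesI.
- by rewrite /Q !preimage_setT L1 probability_setT.
- move=> _ [B0 [B [mB0 mB ->]]]; rewrite /Q.
  (* Both paths start at 0: either [B0] misses 0 and both preimages are empty, or only the
     conditions on increments remain. *)
  have [B00|B00] := pselect (B0 0); last first.
    rewrite (_ : _ @^-1` _ = set0) ?measure0; last first.
      by apply/seteqP; split=> x //= []; rewrite /h W0 D0 addr0.
    rewrite (_ : _ @^-1` _ = set0) ?integral_set0//.
    by apply/seteqP; split=> x //= []; rewrite /f W0.
  rewrite [X in (\int[P]_(x in X) _)%E](_ : _ =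
      \bigcap_(i in [set: 'I_n]) (X i @^-1` B i)); last first.
    apply/seteqP; split=> x /=; rewrite /f W0.
      by move=> [_ H] i _; exact: H.
    by move=> H; split => // i; exact: H.
  rewrite (gauss_shift_density a mX s0 indX lawX mB); congr (P _).
  apply/seteqP; split=> x /=; rewrite /h W0 D0 addr0.
    by move=> [_ H] i _; rewrite /= /X /a addrACA -opprD; exact: H.
  move=> H; split => // i; have := H i I.
  by rewrite /= /X /a addrACA -opprD.
- by move=> S mS; exact: lawC (mf S mS) (mh S mS).
- move=> F mF tF IH.
  have tpre (g : T -> g_sigma_algebraType rectangles) :
      trivIset setT (fun k => g @^-1` F k).
    apply/trivIsetP => i j _ _ ij; rewrite -preimage_setI.
    by move/trivIsetP : tF => ->//; rewrite preimage_set0.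
  have H := lawU (fun k => f @^-1` F k) (fun k => h @^-1` F k)
    (fun k => mf _ (mF k)) (fun k => mh _ (mF k)) (tpre f) (tpre h) IH.
  have Ef : f @^-1` (\bigcup_k F k) = \bigcup_k (f @^-1` F k) :=
    preimage_bigcup _ _ _.
  have Eh : h @^-1` (\bigcup_k F k) = \bigcup_k (h @^-1` F k) :=
    preimage_bigcup _ _ _.
  rewrite /Q Ef Eh; exact: H.
Qed.

(** The tilt bound applied to the exact density; since [s i ^+ 2] is the length of the time step,
    the sum bounded by [N] is the discrete energy of [D]. *)
Lemma grid_shift_le (N k q : R) (A : set (R -> R)) :
  \sum_(i < n) (D (t i.+1) - D (t i)) ^+ 2 / (t i.+1 - t i) <= N -> 1 <= q ->
  <<s evaluations [set t i | i in `I_n.+1] >> A ->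
  (P ((fun x u => W u x + D u)%R @^-1` A) <=
   (expR k)%:E * P ((fun x u => W u x) @^-1` A) +
     (expR ((q - 1) * (q * N / 2 - k)))%:E)%E.
Proof.
move=> aN q1 /evaluations_sub_rectangles sA; rewrite grid_law//.
apply: integral_prod_tilt_le => //.
- rewrite (le_trans _ aN)// ler_sum// => i _.
  by rewrite sqr_sqrtr// subr_ge0 ltW// t_lt.
- rewrite -[_ @^-1` _]setTI.
  set f : T -> g_sigma_algebraType rectangles := fun x u => W u x.
  have mf : measurable_fun [set: T] f by exact: measurable_rect.
  exact: mf.
Qed.

End grid.

Lemma ae_eq_probability d (T : measurableType d) (R : realType)
    (P : probability T R) (A B : set T) : measurable A -> measurable B ->
  {ae P, forall x, A x <-> B x} -> P A = P B.
Proof.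
move=> mA mB AB.
rewrite -[A]setIT -[B]setIT -!(integral_indic P measurableT)//.
apply: ae_eq_integral => //; try by apply/measurable_EFinP.
apply: filterS AB => x AB _; rewrite /= !indicE.
suff -> : (x \in A) = (x \in B) by [].
by apply/idP/idP; rewrite !inE => /AB.
Qed.

(** * Shift inequality for the Wiener process *)

Section cameron_martin.
Context d (T : measurableType d) (R : realType) (P : probability T R).
Variables (w : R -> T -> R) (D : R -> R) (N : R).
Hypothesis hw : wiener_process P w.
Hypothesis D0 : D 0 = 0.
Hypothesis energyD : forall n (t : nat -> R),
  (forall i, (i <= n)%N -> 0 <= t i < 1) ->
  (forall i, (i < n)%N -> t i < t i.+1) ->
  \sum_(i < n) (D (t i.+1) - D (t i)) ^+ 2 / (t i.+1 - t i) <= N.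

Lemma measurable_wiener_shift (E : R -> R) :
  measurable_fun [set: T] ((fun x u => w u x + E u) : T -> path_space R).
Proof.
apply: (@measurable_path R _ T `[0, 1[%classic) => t /=.
rewrite in_itv/= => t01.
by apply: measurable_funD => //; exact: wiener_measurable hw _ t01.
Qed.

(* [w 0] vanishes only almost surely; [W 0] vanishes everywhere. *)
Let W u x := w u x - w 0 x.

Let mW t : 0 <= t < 1 -> measurable_fun [set: T] (W t).
Proof.
move=> t01; apply: measurable_funB; apply: (wiener_measurable hw) => //.
by rewrite lexx/= ltr01.
Qed.

Let measurable_W_shift (E : R -> R) :
  measurable_fun [set: T] ((fun x u => W u x + E u) : T -> path_space R).
Proof.
apply: (@measurable_path R _ T `[0, 1[%classic) => t /=.
rewrite in_itv/= => t01.
by apply: measurable_funD => //; exact: mW.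
Qed.

Let shift_W (E : R -> R) (A : set (path_space R)) : measurable A ->
  P ((fun x u => w u x + E u) @^-1` A) = P ((fun x u => W u x + E u) @^-1` A).
Proof.
move=> mA; apply: ae_eq_probability.
- by rewrite -[_ @^-1` _]setTI; exact: measurable_wiener_shift.
- by rewrite -[_ @^-1` _]setTI; exact: measurable_W_shift.
apply: filterS (wiener_start hw) => x w0 /=.
by rewrite /W w0; under [in X in _ <-> X]eq_fun do rewrite subr0.
Qed.

Lemma cylinder_shift_le (k q : R) (A : set (R -> R)) : 1 <= q ->
  cylinders `[0, 1[ A ->
  (P ((fun x u => W u x + D u)%R @^-1` A) <=
   (expR k)%:E * P ((fun x u => W u x) @^-1` A) +
     (expR ((q - 1) * (q * N / 2 - k)))%:E)%E.
Proof.
move=> q1 [ts ts01 tsA].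
(* Time 0 is added because [W] and [D] vanish there, and duplicates are removed so that every
   increment has positive variance. The larger set of times only enlarges the sigma-algebra. *)
pose r := sort <=%R (undup (0 :: ts)).
have sr : sorted <%R r by rewrite sort_lt_sorted undup_uniq.
have memr x : (x \in r) = (x == 0) || (x \in ts).
  by rewrite mem_sort mem_undup inE.
pose n := (size r).-1.
have sizer : size r = n.+1.
  rewrite prednK// lt0n size_eq0; apply/eqP => r0.
  by have := memr 0; rewrite r0 eqxx.
pose t i := nth 0 r i.
have tr i : (i <= n)%N -> t i \in r by move=> ?; rewrite mem_nth// sizer ltnS.
have t01 i : (i <= n)%N -> 0 <= t i < 1.
  move=> /tr; rewrite memr => /orP[/eqP ->|/ts01/=].
    by rewrite lexx ltr01.
  by rewrite in_itv.
have t_lt i : (i < n)%N -> t i < t i.+1.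
  by move=> jn; rewrite (lt_sorted_ltn_nth 0 sr) ?inE ?sizer ?ltnS// ltnW.
have t0 : t 0%N = 0.
  apply/eqP; rewrite eq_le; apply/andP; split; last first.
    by have /andP[] := t01 0%N isT.
  have : 0 \in r by rewrite memr eqxx.
  move=> /(nthP 0)[j]; rewrite sizer ltnS => jn jE; rewrite -[leRHS]jE.
  by rewrite (lt_sorted_leq_nth 0 sr) ?inE ?sizer.
apply: (@grid_shift_le _ _ _ P W D n t) => //.
- by move=> i /t01; exact: mW.
- by move=> x; rewrite t0 /W subrr.
- by rewrite t0.
- move=> i B mB; rewrite -(wiener_gaussian hw) //.
  + by congr (P (_ @^-1` B)); apply/funext => x; rewrite /W opprB subrKA.
  + by have /andP[] := t01 i (ltnW (ltn_ord i)).
  + exact: t_lt.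
  + by have /andP[] := t01 i.+1 (ltn_ord i).
- have := wiener_independent hw t01 t_lt.
  congr mutually_independent; apply/funext => i; apply/funext => x.
  by rewrite /W opprB subrKA.
- exact: energyD.
- apply: evaluations_sub tsA => x /= xts.
  have : x \in r by rewrite memr xts orbT.
  move=> /(nthP 0)[j jr jE]; exists j => //=.
  by rewrite -sizer.
Qed.

Let addr0_path (v : R -> T -> R) : (fun x u => v u x) = (fun x u => v u x + 0).
Proof. by apply/funext => x; apply/funext => u; rewrite addr0. Qed.

(** As [N] bounds the energy on every grid, the constants are the same for all cylinders and the
    monotone class argument applies. It is run for [W], and the result is carried to [w] by almost
    sure equality. *)
Lemma cameron_martin_le (k q : R) (A : set (path_space R)) : 1 <= q ->
  measurable A ->
  (P ((fun x u => w u x + D u)%R @^-1` A) <=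
   (expR k)%:E * P ((fun x u => w u x) @^-1` A) +
     (expR ((q - 1) * (q * N / 2 - k)))%:E)%E.
Proof.
move=> q1.
pose f : {mfun T >-> path_space R} := HB.pack (fun x u => W u x + 0)
  (isMeasurableFun.Build _ _ _ _ _ (measurable_W_shift (fun=> 0))).
pose h : {mfun T >-> path_space R} := HB.pack (fun x u => W u x + D u)
  (isMeasurableFun.Build _ _ _ _ _ (measurable_W_shift D)).
have mono := @monotone_le_affine _ (path_space R) R
  (distribution P h) (distribution P f)
  (expR k) (expR ((q - 1) * (q * N / 2 - k))) (expR_ge0 _).
have key := g_sigma_algebra_evaluations_sub mono.
move=> mA; have [] := key `[0, 1[%classic _ A mA.
  move=> B cB; split.
    case: cB => ts ts01 tsB; exact: evaluations_sub tsB.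
  have := cylinder_shift_le k q1 cB.
  by rewrite [in X in (_ <= _ * X + _)%E](addr0_path W).
rewrite /distribution /pushforward /= => _ le_A.
by rewrite (addr0_path w) (shift_W D mA) (shift_W (fun=> 0) mA).
Qed.

End cameron_martin.

(** * Energy of the shift and Fisher information *)

Section square_integrable_functions.
Context {R : realType}.
Local Notation mu := (@lebesgue_measure R).
Local Notation I01 := (`[0, 1[%classic : set R).
Implicit Types f g : R -> R.

Let mI01 : measurable (I01 : set (measurableTypeR R)).
Proof. exact: measurable_itv. Qed.

(** Form of [L2] without the extension by zero, convenient for integrals over subintervals. *)
Definition sq_integrable f := measurable_fun I01 f /\
  mu.-integrable I01 (EFin \o (fun t => f t ^+ 2)).

Lemma L2_sq_integrable f : L2 f -> sq_integrable f.
Proof.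
move=> L2f; split.
  move: (L2f); rewrite /L2 inE => /andP[]; rewrite inE/= => mf _.
  exact/(measurable_restrictT _ _).2.
have := Lfun2_integrable_sqr L2f.
move=> H; apply/integrable_mkcond => //; move: H.
congr integrable; apply/funext => x /=.
by rewrite !patchE; case: ifPn => //= _; rewrite expr0n.
Qed.

Lemma sq_integrableM f g : sq_integrable f -> sq_integrable g ->
  mu.-integrable I01 (EFin \o (fun t => f t * g t)).
Proof.
move=> [mf f2] [mg g2].
apply: (@le_integrable _ _ _ mu I01 _ _
  (EFin \o (fun t => f t ^+ 2 + g t ^+ 2))) => //.
- by apply/measurable_EFinP; exact: measurable_funM.
- move=> x _ /=; rewrite lee_fin [leRHS]ger0_norm ?addr_ge0 ?sqr_ge0//.
  by rewrite ler_norml; apply/andP; split; nra.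
- exact: (integrableD mI01 f2 g2).
Qed.

Lemma sq_integrable_cst c : sq_integrable (fun=> c).
Proof.
split => //; apply: measurable_bounded_integrable => //.
  by rewrite /= lebesgue_measure_itv/= lte01 -EFinB ltry.
by exists (`|c ^+ 2|); split; [exact: num_real|move=> ? ? ? _ /=; exact: ltW].
Qed.

Lemma sq_integrable_int f : sq_integrable f -> mu.-integrable I01 (EFin \o f).
Proof.
move=> /sq_integrableM /(_ (sq_integrable_cst 1)).
by congr integrable; apply/funext => x /=; rewrite mulr1.
Qed.

Lemma sq_integrableD f g : sq_integrable f -> sq_integrable g ->
  sq_integrable (fun t => f t + g t).
Proof.
move=> Hf Hg; have [mf f2] := Hf; have [mg g2] := Hg; split.
  exact: measurable_funD.
have fg := sq_integrableM Hf Hg.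
have := integrableD mI01 f2 (integrableD mI01 (integrableZl mI01 2 fg) g2).
congr integrable; apply/funext => x /=.
by rewrite -EFinM -!EFinD; congr (_%:E); ring.
Qed.

Lemma sq_integrableZ c f : sq_integrable f -> sq_integrable (fun t => c * f t).
Proof.
move=> [mf f2]; split; first exact: measurable_funM.
have := integrableZl mI01 (c ^+ 2) f2.
by congr integrable; apply/funext => x /=; rewrite -EFinM exprMn.
Qed.

Lemma sq_integrableB f g : sq_integrable f -> sq_integrable g ->
  sq_integrable (fun t => f t - g t).
Proof.
move=> Hf Hg; under eq_fun do rewrite -[X in _ - X]mul1r -mulNr.
by apply: sq_integrableD => //; exact: sq_integrableZ.
Qed.

Lemma sq_integrable_sum n (c : 'I_n -> R -> R) :
  (forall i, sq_integrable (c i)) ->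
  sq_integrable (fun t => \sum_i c i t).
Proof.
move=> Hc; elim: (index_enum _) => [|i r IH].
  by under eq_fun do rewrite big_nil; exact: sq_integrable_cst.
by under eq_fun do rewrite big_cons; exact: sq_integrableD.
Qed.

Let itv_sub (c e : R) (b : bool) : 0 <= c -> e < 1 ->
  [set` Interval (BSide b c) (BRight e)] `<=` I01.
Proof.
move=> c0 e1 x /=; rewrite !in_itv/= => /andP[cx xe].
rewrite (le_lt_trans xe e1) andbT (le_trans c0)//.
by case: b cx => //= /ltW.
Qed.

Lemma Rintegral_increment f c e : mu.-integrable I01 (EFin \o f) ->
  0 <= c -> c <= e -> e < 1 ->
  \int[mu]_(x in `[0, e]) f x - \int[mu]_(x in `[0, c]) f x
  = \int[mu]_(x in `]c, e]) f x.
Proof.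
move=> f1 c0 ce e1; rewrite Rintegral_itvB ?bnd_simp//.
by apply: integrableS f1 => //; exact: itv_sub.
Qed.

(* Expand [0 <= \int (f - m)^2] with [m] the mean of [f] over the interval. *)
Lemma sqr_Rintegral_le f c e : sq_integrable f -> 0 <= c -> c < e -> e < 1 ->
  (\int[mu]_(x in `]c, e]) f x) ^+ 2 / (e - c)
  <= \int[mu]_(x in `]c, e]) f x ^+ 2.
Proof.
move=> Hf c0 ce e1; have [mf f2] := Hf.
pose J := `]c, e]%classic.
have JI : J `<=` I01 by exact: itv_sub.
have mJ : measurable (J : set (measurableTypeR R)) by exact: measurable_itv.
have intJ g : mu.-integrable I01 (EFin \o g) -> mu.-integrable J (EFin \o g).
  by move=> Hg; exact: integrableS Hg.
have i1 := intJ _ (sq_integrable_int Hf).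
have i2 := intJ _ f2.
pose m := (\int[mu]_(x in J) f x) / (e - c).
have ec0 : 0 < e - c by rewrite subr_gt0.
have i3 : mu.-integrable J (EFin \o (fun x => - (2 * m) * f x)).
  exact: (integrableZl mJ (- (2 * m)) i1).
have i4 : mu.-integrable J (EFin \o (fun=> m ^+ 2)).
  exact: intJ (sq_integrable_int (sq_integrable_cst _)).
have i34 : mu.-integrable J (EFin \o (fun x => - (2 * m) * f x + m ^+ 2)).
  exact: (integrableD mJ i3 i4).
have : 0 <= \int[mu]_(x in J) (f x ^+ 2 + (- (2 * m) * f x + m ^+ 2)).
  apply: Rintegral_ge0 => x _.
  by rewrite (_ : _ + _ = (f x - m) ^+ 2) ?sqr_ge0//; ring.
rewrite RintegralD// RintegralD// RintegralZl// Rintegral_cst//.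
have -> : fine (mu J) = e - c.
  by rewrite /= lebesgue_measure_itv/= lte_fin ce.
rewrite -/J /m.
move: (\int[mu]_(x in J) f x) (\int[mu]_(x in J) f x ^+ 2) => A B.
rewrite -subr_ge0; congr (0 <= _); field.
by rewrite gt_eqF.
Qed.

(** Cauchy-Schwarz on each grid interval bounds its term by the increment of [Q], the integral of
    [f ^+ 2] up to the given time; the increments telescope. *)
Lemma energy_le f n (t : nat -> R) : sq_integrable f ->
  (forall i, (i <= n)%N -> 0 <= t i < 1) ->
  (forall i, (i < n)%N -> t i < t i.+1) ->
  \sum_(i < n) (\int[mu]_(x in `[0, t i.+1]) f x
     - \int[mu]_(x in `[0, t i]) f x) ^+ 2 / (t i.+1 - t i)
  <= \int[mu]_(x in I01) f x ^+ 2.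
Proof.
move=> Hf t01 t_lt; have [mf f2] := Hf.
pose Q i := \int[mu]_(x in `[0, t i]) f x ^+ 2.
have Qn i : (i <= n)%N -> Q i <= \int[mu]_(x in I01) f x ^+ 2.
  move=> ilen; have /andP[ti0 ti1] := t01 i ilen.
  rewrite /Q [leLHS]Rintegral_mkcond [leRHS]Rintegral_mkcond.
  have sub : `[0, t i]%classic `<=` I01 by exact: itv_sub.
  apply: le_Rintegral => //.
  + rewrite -restrict_EFin -integrable_mkcond//; exact: integrableS f2.
  + by rewrite -restrict_EFin -integrable_mkcond.
  + move=> x _; rewrite !patchE; case: ifPn => [|_].
      by rewrite inE => /sub x01; rewrite mem_set.
    by case: ifPn => // _; exact: sqr_ge0.
apply: (le_trans _ (Qn n (leqnn n))).
apply: (@le_trans _ _ (\sum_(i < n) (Q i.+1 - Q i))).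
  apply: ler_sum => i _.
  have /andP[ti0 ti1] := t01 i (ltnW (ltn_ord i)).
  have /andP[tj0 tj1] := t01 i.+1 (ltn_ord i).
  have tij := t_lt i (ltn_ord i).
  rewrite /Q (Rintegral_increment (sq_integrable_int Hf) ti0 (ltW tij) tj1).
  rewrite (Rintegral_increment f2 ti0 (ltW tij) tj1).
  exact: sqr_Rintegral_le.
rewrite -(big_mkord xpredT (fun i => Q i.+1 - Q i)) telescope_sumr//.
by rewrite gerBl; apply: Rintegral_ge0 => x _; exact: sqr_ge0.
Qed.

End square_integrable_functions.

(** * Fisher quadratic form and distance between nearby signals *)

Section fisher.
Context {R : realType} {d : nat}.
Local Notation mu := (@lebesgue_measure R).
Local Notation I01 := (`[0, 1[%classic : set R).

Let mI01 : measurable (I01 : set (measurableTypeR R)).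
Proof. exact: measurable_itv. Qed.

(** Integrability of the sum is part of the conclusion because the induction, and later the double
    sum, require it. *)
Lemma Rintegral_sum (I : Type) (r : seq I) (f : I -> R -> R) :
  (forall i, mu.-integrable I01 (EFin \o f i)) ->
  mu.-integrable I01 (EFin \o (fun t => \sum_(i <- r) f i t)) /\
  \int[mu]_(t in I01) (\sum_(i <- r) f i t) =
  \sum_(i <- r) \int[mu]_(t in I01) f i t.
Proof.
move=> Hf; elim: r => [|i r [IH1 IH2]].
  have -> : (fun t => \sum_(i <- [::]) f i t) = (fun=> 0).
    by apply/funext => t; rewrite big_nil.
  rewrite big_nil; split.
    exact: (sq_integrable_int (sq_integrable_cst 0)).
  by rewrite Rintegral_cst// mul0r.
have -> : (fun t => \sum_(j <- i :: r) f j t) =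
    (fun t => f i t + \sum_(j <- r) f j t).
  by apply/funext => t; rewrite big_cons.
rewrite big_cons; split.
  exact: (integrableD mI01 (Hf i) IH1).
by rewrite RintegralD// IH2.
Qed.

Lemma fisher_quadform (Sdot : R -> 'cV[R]_d) (v : 'cV[R]_d) :
  (forall i, L2 (fun t => Sdot t i 0)) ->
  \int[mu]_(t in I01) ((Sdot t)^T *m v) 0 0 ^+ 2 =
  quadform (fisher_matrix Sdot) v.
Proof.
move=> L2S; have sqS i := L2_sq_integrable (L2S i).
have int_ij i j : mu.-integrable I01 (EFin \o (fun t =>
    v i 0 * v j 0 * (Sdot t i 0 * Sdot t j 0))).
  exact: (integrableZl mI01 (v i 0 * v j 0) (sq_integrableM (sqS i) (sqS j))).
transitivity (\int[mu]_(t in I01) \sum_j \sum_i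
    v i 0 * v j 0 * (Sdot t i 0 * Sdot t j 0)).
  apply: eq_Rintegral => t _; rewrite mxE expr2 big_distrl/= exchange_big/=.
  apply: eq_bigr => i _; rewrite big_distrr/=; apply: eq_bigr => j _.
  by rewrite !mxE; ring.
rewrite (Rintegral_sum _
  (fun j => (Rintegral_sum _ (fun i => int_ij i j)).1)).2.
rewrite /quadform mxE; apply: eq_bigr => j _.
rewrite (Rintegral_sum _ (fun i => int_ij i j)).2 mxE big_distrl/=.
apply: eq_bigr => i _; rewrite !mxE RintegralZl//; last exact: sq_integrableM.
rewrite mulrAC; congr (_ * _ * _).
by apply: eq_Rintegral => t _; rewrite mxE big_ord1 mxE.
Qed.

Lemma sq_integrable_scalar (Sdot : R -> 'cV[R]_d) (v : 'cV[R]_d) :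
  (forall i, L2 (fun t => Sdot t i 0)) ->
  sq_integrable (fun t => ((Sdot t)^T *m v) 0 0).
Proof.
move=> L2S; under eq_fun do rewrite mxE.
apply: sq_integrable_sum => i; under eq_fun do rewrite mulrC mxE.
by apply: sq_integrableZ; exact: L2_sq_integrable.
Qed.

Lemma quadformZ (A : 'M[R]_d) (c : R) (v : 'cV[R]_d) :
  quadform A (c *: v) = c ^+ 2 * quadform A v.
Proof.
rewrite /quadform -scalemxAr mxE linearZ/= -!scalemxAl mxE.
by rewrite mulrA expr2.
Qed.

Lemma enorm_sqr (v : 'cV[R]_d) : enorm v ^+ 2 = \sum_(i < d) v i 0 ^+ 2.
Proof. by rewrite sqr_sqrtr// sumr_ge0// => i _; exact: sqr_ge0. Qed.

Lemma enormZ_sqr (c : R) (v : 'cV[R]_d) :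
  enorm (c *: v) ^+ 2 = c ^+ 2 * enorm v ^+ 2.
Proof.
by rewrite !enorm_sqr mulr_sumr; apply: eq_bigr => i _; rewrite mxE exprMn.
Qed.

(** Pointwise, [(l + r)^2 <= (1 + b) l^2 + (1 + b^-1) r^2], with [l] the linear part of the
    difference and [r] the remainder. A small [b] keeps the constant of the main term close to 1. *)
Lemma signal_distance_le (S : 'cV[R]_d -> R -> R) (Sdot : R -> 'cV[R]_d)
    (theta theta' : 'cV[R]_d) (b : R) : 0 < b ->
  L2 (S theta) -> L2 (S theta') -> (forall i, L2 (fun t => Sdot t i 0)) ->
  \int[mu]_(t in I01) (S theta' t - S theta t) ^+ 2 <=
  (1 + b) * quadform (fisher_matrix Sdot) (theta' - theta)
  + (1 + b^-1) * \int[mu]_(t in I01)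
      (S theta' t - S theta t - ((Sdot t)^T *m (theta' - theta)) 0 0) ^+ 2.
Proof.
move=> b0 L2a L2b L2S.
have Hh := sq_integrableB (L2_sq_integrable L2b) (L2_sq_integrable L2a).
have Hv := sq_integrable_scalar (theta' - theta) L2S.
have Hr := sq_integrableB Hh Hv.
rewrite -fisher_quadform// -!RintegralZl//; last 2 first.
- exact: Hr.2.
- exact: Hv.2.
rewrite -RintegralD//; last 2 first.
- exact: (integrableZl mI01 (1 + b) Hv.2).
- exact: (integrableZl mI01 (1 + b^-1) Hr.2).
apply: le_Rintegral => //.
- exact: Hh.2.
- exact: (integrableD mI01 (integrableZl mI01 (1 + b) Hv.2)
            (integrableZl mI01 (1 + b^-1) Hr.2)).
move=> t _; set h := S theta' t - S theta t; set l := (_ *m _) 0 0.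
rewrite -subr_ge0 (_ : _ - _ = b * (l - b^-1 * (h - l)) ^+ 2).
  by rewrite mulr_ge0 ?sqr_ge0// ltW.
by field; rewrite gt_eqF.
Qed.

Lemma cvg_local_alternative (u : R -> R) (theta tau : 'cV[R]_d) :
  u eps @[eps --> 0^'+] --> 0 ->
  (theta + u eps *: tau) @[eps --> 0^'+] --> theta.
Proof.
move=> u0; rewrite -[X in _ --> X]addr0.
apply: cvgD; first exact: cvg_cst.
rewrite -(scale0r tau); apply: cvgZr_tmp => //.
Qed.

Lemma near_signal_distance_le (Theta : set 'cV[R]_d) (S : 'cV[R]_d -> R -> R)
    (Sdot : R -> 'cV[R]_d) (u : R -> R) (theta tau : 'cV[R]_d) (rho : R) :
  open Theta -> Theta theta -> (forall th, Theta th -> L2 (S th)) ->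
  finite_fisher S theta Sdot ->
  u eps @[eps --> 0^'+] --> 0 -> 0 < rho ->
  \forall eps \near 0^'+,
  \int[mu]_(t in I01) (S (theta + u eps *: tau) t - S theta t) ^+ 2 <=
  u eps ^+ 2 * (quadform (fisher_matrix Sdot) tau + rho).
Proof.
move=> oTheta Ttheta L2S [L2Sdot /eqoP oS posI] u0 rho0.
set Q := quadform _ tau.
have Q0 : 0 <= Q.
  by rewrite /Q -fisher_quadform//; apply: Rintegral_ge0 => t _; exact: sqr_ge0.
pose E := enorm tau ^+ 2.
have E0 : 0 <= E by exact: sqr_ge0.
(* [b] and then [e] are chosen so that the excess [b * Q] of the main term and the remainder
   [(1 + b^-1) * e * E] are each at most [rho / 2]; the added ones keep the denominators positive
   when [Q] or [E] is 0. *)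
pose b := rho / (2 * (Q + 1)).
have b0 : 0 < b by rewrite divr_gt0// mulr_gt0// ltr_wpDl.
pose e := rho / (2 * (1 + b^-1) * (E + 1)).
have b1 : 0 < 1 + b^-1 by rewrite ltr_wpDr// invr_ge0 ltW.
have e0 : 0 < e by rewrite divr_gt0// !mulr_gt0// ltr_wpDl.
have cv := @cvg_local_alternative u theta tau u0.
have nT : \forall eps \near 0^'+, Theta (theta + u eps *: tau).
  by apply: cv; exact: open_nbhs_nbhs.
have nR := cv _ (oS e e0).
near=> eps.
have Tth : Theta (theta + u eps *: tau) by near: eps.
apply: (le_trans (signal_distance_le b0 (L2S _ Ttheta) (L2S _ Tth) L2Sdot)).
have : `| \int[mu]_(t in I01) (S (theta + u eps *: tau) t - S theta t -
     ((Sdot t)^T *m (theta + u eps *: tau - theta)) 0 0) ^+ 2 | <=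
     e * `| enorm (theta + u eps *: tau - theta) ^+ 2 | by near: eps.
rewrite [theta + _ - theta]addrC addKr quadformZ enormZ_sqr -/Q -/E.
move=> /(le_trans (ler_norm _)); set I := Rintegral _ _ _.
rewrite ger0_norm; last by rewrite mulr_ge0// sqr_ge0.
move=> le_I.
have u20 : 0 <= u eps ^+ 2 by exact: sqr_ge0.
apply: (@le_trans _ _ ((1 + b) * (u eps ^+ 2 * Q) +
                       (1 + b^-1) * (e * (u eps ^+ 2 * E)))).
  by rewrite lerD2l ler_wpM2l// ltW.
rewrite (_ : _ + _ = u eps ^+ 2 * ((1 + b) * Q + (1 + b^-1) * e * E));
  last by ring.
rewrite ler_wpM2l//.
have bQ : b * Q <= rho / 2.
  rewrite /b (_ : _ * Q = rho / 2 * (Q / (Q + 1))); last first.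
    by field; rewrite gt_eqF// ltr_wpDl.
  apply: ler_piMr; first by rewrite divr_ge0// ltW.
  by rewrite ler_pdivrMr ?mul1r ?lerDl// ltr_wpDl.
have eE : (1 + b^-1) * e * E <= rho / 2.
  rewrite /e; move: (1 + b^-1) b1 => c c0.
  rewrite (_ : _ * E = rho / 2 * (E / (E + 1))); last first.
    by field; rewrite !gt_eqF// ltr_wpDl.
  apply: ler_piMr; first by rewrite divr_ge0// ltW.
  by rewrite ler_pdivrMr ?mul1r ?lerDl// ltr_wpDl.
rewrite mulrDl mul1r -addrA lerD2l; lra.
Unshelve. all: by end_near.
Qed.

End fisher.

(** * Lower bound for the deviation probability *)

Section law_shift.
Context (R : realType) (d : nat) (disp : measure_display)
  (T : measurableType disp) (P : probability T R) (w : R -> T -> R).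
Hypothesis hw : wiener_process P w.
Variable S : 'cV[R]_d -> R -> R.
Local Notation mu := (@lebesgue_measure R).

Lemma measurable_observation (eps : R) (theta : 'cV[R]_d) :
  measurable_fun [set: T] (observation w S eps theta).
Proof.
apply: (@measurable_path R _ T `[0, 1[%classic) => t /=.
rewrite in_itv/= => t01.
apply: measurable_funD => //; apply: measurable_funM => //.
exact: wiener_measurable hw _ t01.
Qed.

(** The two observations are the images under one affine map [phi] of [w] and of [w + D], with [D]
    the integrated signal difference divided by [eps]. The inequality for shifts of [w] is applied
    to the preimage of [A] under [phi]. *)
Lemma law_shift_le (eps : R) (theta theta' : 'cV[R]_d) (N k q : R)
    (A : set (path_space R)) : 0 < eps ->
  L2 (S theta) -> L2 (S theta') -> 1 <= q -> measurable A ->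
  \int[mu]_(t in `[0, 1[) (S theta' t - S theta t) ^+ 2 <= eps ^+ 2 * N ->
  (law P w S eps theta' A <= (expR k)%:E * law P w S eps theta A
    + (expR ((q - 1) * (q * N / 2 - k)))%:E)%E.
Proof.
move=> eps0 L2a L2b q1 mA leN.
have epsN0 : eps != 0 by rewrite gt_eqF.
pose F t := \int[mu]_(s in `[0, t]) S theta s.
pose D t := (\int[mu]_(s in `[0, t]) S theta' s - F t) / eps.
pose phi : path_space R -> path_space R := fun y t => F t + eps * y t.
have mphi : measurable_fun [set: path_space R] phi.
  apply: (@measurable_path R _ (path_space R) `[0, 1[%classic) => t t01.
  apply: measurable_funD => //; apply: measurable_funM => //.
  exact: (@measurable_evaluation R `[0, 1[%classic t t01).
have mphiA : measurable (phi @^-1` A).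
  by rewrite -[_ @^-1` _]setTI; exact: mphi.
have obsE : observation w S eps theta = (fun x => phi (fun u => w u x)) by [].
have obsE' : observation w S eps theta' = (fun x => phi (fun u => w u x + D u)).
  apply/funext => x; apply/funext => t; rewrite /observation /phi /D mulrDr.
  by rewrite [eps * (_ / eps)]mulrC divfK// addrCA [F t + _]addrC subrK addrC.
have D0 : D 0 = 0.
  by rewrite /D /F set_itv1 !Rintegral_set1 subrr mul0r.
have Ha := L2_sq_integrable L2a; have Hb := L2_sq_integrable L2b.
have energyD n (t : nat -> R) : (forall i, (i <= n)%N -> 0 <= t i < 1) ->
    (forall i, (i < n)%N -> t i < t i.+1) ->
    \sum_(i < n) (D (t i.+1) - D (t i)) ^+ 2 / (t i.+1 - t i) <= N.
  move=> t01 t_lt.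
  have Hh := sq_integrableB Hb Ha.
  have := le_trans (energy_le Hh t01 t_lt) leN.
  rewrite -ler_pdivrMl ?exprn_gt0//; apply: le_trans.
  rewrite mulr_sumr; apply: ler_sum => i _.
  have DE j : (j <= n)%N ->
      D (t j) = (\int[mu]_(s in `[0, t j]) (S theta' s - S theta s)) / eps.
    move=> jn; have /andP[tj0 tj1] := t01 j jn; rewrite /D /F RintegralB//.
    - apply: integrableS (sq_integrable_int Hb) => //.
      by move=> x /=; rewrite !in_itv/= => /andP[-> /le_lt_trans ->].
    - apply: integrableS (sq_integrable_int Ha) => //.
      by move=> x /=; rewrite !in_itv/= => /andP[-> /le_lt_trans ->].
  rewrite !DE//; last exact: ltnW.
  by rewrite -mulrBl exprMn exprVn mulrA [_ * eps ^- 2]mulrC.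
have := cameron_martin_le hw D0 energyD k q1 mphiA.
by rewrite /law /pushforward obsE obsE'.
Qed.

End law_shift.

(** * Euclidean norm, limits inferior and measurability *)

Section euclidean_norm.
Context {R : realType} {d : nat}.
Implicit Types x : 'cV[R]_d.

Lemma ler_coord_enorm x i : `|x i 0| <= enorm x.
Proof.
rewrite -sqrtr_sqr ler_wsqrtr// (bigD1 i)//= lerDl sumr_ge0// => j _.
exact: sqr_ge0.
Qed.

Lemma enormZ (c : R) x : 0 <= c -> enorm (c *: x) = c * enorm x.
Proof.
move=> c0; apply/eqP; rewrite -(@eqrXn2 _ 2)// ?sqrtr_ge0//.
  by rewrite exprMn enormZ_sqr.
by rewrite mulr_ge0// sqrtr_ge0.
Qed.

Lemma continuous_enorm : continuous (@enorm R d).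
Proof.
move=> x; apply: (continuous_comp
  (f := fun x : 'cV[R]_d => \sum_(i < d) x i 0 ^+ 2));
  last exact: sqrt_continuous.
have sumC (r : seq 'I_d) :
    continuous (fun x : 'cV[R]_d => \sum_(i <- r) x i 0 ^+ 2).
  elim: r => [|i r IH].
    rewrite (_ : (fun x => _) = cst 0); first exact: cst_continuous.
    by apply/funext => y; rewrite big_nil.
  rewrite (_ : (fun x => _) =
      (fun x : 'cV[R]_d => x i 0 ^+ 2 + \sum_(j <- r) x j 0 ^+ 2)).
    have sqrC : continuous (fun x : 'cV[R]_d => x i 0 ^+ 2).
      move=> y; apply: (@continuous_comp _ _ _ (fun x : 'cV[R]_d => x i 0)
        (fun t : R => t ^+ 2)); first exact: coord_continuous.
      exact: exprn_continuous.
    by move=> y; exact: (cvgD (sqrC y) (IH y)).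
  by apply/funext => y; rewrite big_cons.
exact: sumC.
Qed.

Lemma measurable_open_preimage d' (Y : measurableType d')
    (f : Y -> 'cV[R]_d) (O : set 'cV[R]_d) :
  measurable_fun [set: Y] (f : Y -> borel_cV R d) -> open O ->
  measurable (f @^-1` O).
Proof.
move=> mf oO; rewrite -[_ @^-1` _]setTI; apply: mf => //.
exact: sub_sigma_algebra.
Qed.

End euclidean_norm.

Lemma limf_einf_ge (R : realType) (F : set_system R) (f : R -> \bar R)
    (c : \bar R) :
  (\forall x \near F, (c <= f x)%E) -> (c <= limf_einf f F)%E.
Proof.
move=> Fc; rewrite limf_einfE.
apply: (@le_trans _ _ (ereal_inf (f @` [set x | (c <= f x)%E]))).
  by apply: le_ereal_inf_tmp => _ [x cx <-].
by apply: ereal_sup_ubound; exists [set x | (c <= f x)%E].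
Qed.

Lemma continuous_subr (R : realType) (d : nat) (v : 'cV[R]_d) :
  continuous (fun z : 'cV[R]_d => z - v).
Proof. by move=> z; exact: (cvgB (@cvg_id _ (nbhs z)) (cvg_cst v)). Qed.

Section lower_bound.
Context (R : realType) (d : nat) (disp : measure_display)
  (T : measurableType disp) (P : probability T R) (w : R -> T -> R).
Hypothesis hw : wiener_process P w.
Variables (S : 'cV[R]_d -> R -> R) (est : R -> path_space R -> 'cV[R]_d).
Hypothesis hest : estimator est.

Let deviation (u : R) eps (theta : 'cV[R]_d) (V : set 'cV[R]_d) :
    set (path_space R) :=
  [set y | [set u *: tau | tau in V] (est eps y - theta)].

Lemma measurable_law_preimage eps theta A : measurable A ->
  measurable (observation w S eps theta @^-1` A).
Proof.
move=> mA; rewrite -[_ @^-1` _]setTI.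
exact: measurable_observation hw _ _ _ measurableT _ mA.
Qed.

(** Rewriting the image as a preimage under a continuous map gives measurability for open [V]. *)
Lemma deviationE (u : R) eps (theta : 'cV[R]_d) (V : set 'cV[R]_d) : u != 0 ->
  deviation u eps theta V = est eps @^-1` [set z | V (u^-1 *: (z - theta))].
Proof.
move=> u0; apply/seteqP; split => y /=.
  by move=> [tau Vtau <-]; rewrite scalerA mulVf// scale1r.
move=> HV; exists (u^-1 *: (est eps y - theta)) => //.
by rewrite scalerA divff// scale1r.
Qed.

Lemma measurable_deviation (u : R) eps (theta : 'cV[R]_d) (V : set 'cV[R]_d) :
  0 < eps -> u != 0 -> open V -> measurable (deviation u eps theta V).
Proof.
move=> eps0 u0 oV; rewrite deviationE//.
apply: measurable_open_preimage; first exact: hest.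
apply: (@open_comp _ _ (fun z : 'cV[R]_d => u^-1 *: (z - theta)) V) => // z _.
exact: (cvgZ (cvg_cst u^-1) (@continuous_subr R d theta z)).
Qed.

Lemma measurable_large_error (r : R) eps (theta : 'cV[R]_d) : 0 < eps ->
  measurable [set y : path_space R | r < enorm (est eps y - theta)].
Proof.
move=> eps0.
apply: (@measurable_open_preimage _ _ _ _ (est eps)
  [set z | r < enorm (z - theta)]).
  exact: hest.
apply: (@open_comp _ _ (fun z : 'cV[R]_d => enorm (z - theta)) [set x | r < x]).
  move=> z _; apply: (@continuous_comp _ _ _
    (fun z : 'cV[R]_d => z - theta) (@enorm R d)).
    exact: continuous_subr.
  exact: continuous_enorm.
exact: open_gt.
Qed.

Lemma near_ball_sub (V : set 'cV[R]_d) (tau : 'cV[R]_d) : open V -> V tau ->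
  exists2 delta : R, 0 < delta & forall x, enorm (x - tau) <= delta -> V x.
Proof.
move=> oV Vtau.
have /nbhs_ballP[e /= e0 eV] : nbhs tau V by exact: open_nbhs_nbhs.
(* Each coordinate is bounded by the Euclidean norm; halving the radius turns the weak inequality
   into the strict one of the open ball. *)
exists (e / 2); first by rewrite divr_gt0.
move=> x xe; apply: eV; split => // i j; rewrite ord1 /ball/= distrC.
have := ler_coord_enorm (x - tau) i; rewrite !mxE => /le_lt_trans; apply.
by rewrite (le_lt_trans xe)// ltr_pdivrMr// ltr_pMr// ltr1n.
Qed.

(** When the estimator is within [delta * u] of [theta + u *: tau], its rescaled deviation from
    [theta] is within [delta] of [tau], hence in [V]. So the deviation and large-error events cover
    the space. *)
Lemma law_deviation_ge (u eps delta : R) (theta tau : 'cV[R]_d)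
    (V : set 'cV[R]_d) :
  0 < eps -> 0 < u -> open V ->
  (forall x, enorm (x - tau) <= delta -> V x) ->
  (1 - law P w S eps (theta + u *: tau)
      [set y | (delta * u < enorm (est eps y - (theta + u *: tau)))%R]
   <= law P w S eps (theta + u *: tau) (deviation u eps theta V))%E.
Proof.
move=> eps0 u0 oV subV.
have uN0 : u != 0 by rewrite gt_eqF.
set theta' := theta + u *: tau.
rewrite leeBlDr; last first.
  apply: fin_num_measure; apply: measurable_law_preimage.
  exact: measurable_large_error.
have mA := measurable_law_preimage eps theta'
  (measurable_deviation theta eps0 uN0 oV).
have mB := measurable_law_preimage eps theta'
  (measurable_large_error (delta * u) theta' eps0).
apply: (le_trans _ (measureU2 P mA mB)).
rewrite -(@probability_setT _ _ _ P); apply: le_measure; rewrite ?inE//.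
  exact: measurableU.
move=> x _; have [|le_d] := ltP (delta * u)
  (enorm (est eps (observation w S eps theta' x) - theta')).
  by right.
left; rewrite /= deviationE//=; apply: subV.
have -> : u^-1 *: (est eps (observation w S eps theta' x) - theta) - tau
   = u^-1 *: (est eps (observation w S eps theta' x) - theta').
  by rewrite /theta' opprD addrA [RHS]scalerBr scalerA mulVf// scale1r.
by rewrite enormZ ?invr_ge0 ?(ltW u0)// ler_pdivrMl// mulrC.
Qed.

(* [q := 1 + rho], [N := M (Q + rho)] and [k := q N / 2 + rho M]
   with [M := (u / eps)^2]. *)
Lemma lne_law_ge (u eps Q rho : R) (theta theta' : 'cV[R]_d)
    (A : set (path_space R)) :
  0 < eps -> 0 < u -> L2 (S theta) -> L2 (S theta') -> measurable A ->
  0 < rho -> rho <= 1 -> 3 / rho ^+ 2 <= (eps^-1 * u) ^+ 2 ->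
  \int[lebesgue_measure]_(t in `[0, 1[) (S theta' t - S theta t) ^+ 2
    <= u ^+ 2 * (Q + rho) ->
  ((3 / 4)%:E <= law P w S eps theta' A)%E ->
  ((- ((1 + rho) * (Q + rho) / 2 + 2 * rho))%:E <=
    (eps ^+ 2 * u ^- 2)%:E * lne (law P w S eps theta A))%E.
Proof.
move=> eps0 u0 L2a L2b mA rho0 rho1.
set M := (eps^-1 * u) ^+ 2 => MK le_dist nuA.
have M0 : 0 < M by rewrite exprn_gt0// mulr_gt0// invr_gt0.
have rho20 : 0 < rho ^+ 2 by rewrite exprn_gt0.
have M3 : 3 <= rho ^+ 2 * M by rewrite mulrC -ler_pdivrMr.
pose q := 1 + rho; pose N := M * (Q + rho); pose k := q * N / 2 + rho * M.
have epsN0 : eps != 0 by rewrite gt_eqF.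
have uN0 : u != 0 by rewrite gt_eqF.
have eN : u ^+ 2 * (Q + rho) = eps ^+ 2 * N by rewrite /N /M; field.
rewrite eN in le_dist.
have q1 : 1 <= q by rewrite lerDl ltW.
have := law_shift_le hw k eps0 L2a L2b q1 mA le_dist.
move=> /(le_trans nuA).
have -> : (q - 1) * (q * N / 2 - k) = - (rho ^+ 2 * M) by rewrite /k /q; ring.
(* From [rho ^+ 2 * M >= 3] and [1 + x <= exp x]; out of the mass [3 / 4] at least [1 / 2] is left
   for [e^k] times the probability under [theta]. *)
have eta4 : expR (- (rho ^+ 2 * M)) <= 4^-1.
  rewrite expRN lef_pV2 ?posrE ?expR_gt0//.
  by have := expR_ge1Dx (rho ^+ 2 * M); lra.
have muA_fin : law P w S eps theta A \is a fin_num.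
  by apply: fin_num_measure; exact: measurable_law_preimage.
rewrite -(fineK muA_fin) -EFinM -EFinD lee_fin.
set m := fine _ => le_m.
have m_ge : expR (- k) / 2 <= m.
  rewrite expRN mulrC ler_pdivrMr ?expR_gt0// mulrC; lra.
have m0 : 0 < m by apply: lt_le_trans m_ge; rewrite divr_gt0// expR_gt0.
rewrite lne_EFin// -EFinM lee_fin.
have -> : eps ^+ 2 * u ^- 2 = M^-1 by rewrite /M; field; rewrite uN0 epsN0.
rewrite ler_pdivlMl//.
apply: (@le_trans _ _ (ln (expR (- k) / 2))); last first.
  by rewrite ler_ln ?posrE// divr_gt0// expR_gt0.
rewrite lnM ?posrE ?expR_gt0 ?invr_gt0// expRK lnV ?posrE//.
(* The factor [1 / 2] costs [ln 2], which is below [rho ^+ 2 * M <= rho * M]; this gives the second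
   [rho * M] in the bound. *)
have ln2 : ln (2 : R) <= 1 by rewrite -[2]/(1 + 1) le_ln1Dx//; lra.
have : rho ^+ 2 * M <= rho * M.
  by rewrite ler_pM2r// expr2 ler_piMr// ltW.
have -> : M * - ((1 + rho) * (Q + rho) / 2 + 2 * rho) =
    - (q * N / 2) - 2 * (rho * M) by rewrite /q /N; field.
by rewrite /k; move: (rho * M) (rho ^+ 2 * M) M3 => a b; lra.
Qed.

End lower_bound.

Theorem theorem2p7 (R : realType) (d : nat)
  (disp : measure_display) (T : measurableType disp) (P : probability T R)
  (w : R -> T -> R) (hw : wiener_process P w)
  (Theta : set 'cV[R]_d) (hTheta : open Theta)
  (S : 'cV[R]_d -> R -> R) (hS : forall theta, Theta theta -> L2 (S theta))
  (u : R -> R) (hu : forall eps : R, 0 < eps -> 0 < u eps)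
  (hu0 : u eps @[eps --> 0^'+] --> 0)
  (huoo : eps^-1 * u eps @[eps --> 0^'+] --> +oo)
  (Sdot : 'cV[R]_d -> R -> 'cV[R]_d)
  (hfisher : forall theta, Theta theta -> finite_fisher S theta (Sdot theta))
  (est : R -> path_space R -> 'cV[R]_d) (hest : estimator est)
  (hcons : consistent Theta (law P w S) u est)
  (theta : 'cV[R]_d) (htheta : Theta theta)
  (V : set 'cV[R]_d) (hV : open V) :
  ((- 2^-1)%:E *
     ereal_inf [set (quadform (fisher_matrix (Sdot theta)) tau)%:E | tau in V]
   <= limf_einf
        (fun eps : R => (eps ^+ 2 * (u eps) ^- 2)%:E *
           lne (law P w S eps theta
                  [set y | [set u eps *: tau | tau in V] (est eps y - theta)%R]))
        0^'+)%E.
Proof.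
set f := (X in limf_einf X _).
set A := fun eps : R =>
  [set y | [set u eps *: tau | tau in V] (est eps y - theta)].
suff lower tau : V tau ->
    ((- (quadform (fisher_matrix (Sdot theta)) tau / 2))%:E
     <= limf_einf f 0^'+)%E.
  (* Moving the negative factor across turns the claim into a lower bound for the infimum, which is
     checked one [tau] at a time and vacuously for empty [V]. *)
  rewrite -[(- 2^-1)%R]invrN lee_ndivrMl ?oppr_lt0//.
  apply: le_ereal_inf_tmp => _ [tau Vtau <-].
  rewrite -lee_ndivrMl ?oppr_lt0// -EFinM.
  by apply: le_trans (lower tau Vtau); rewrite lee_fin invrN mulNr mulrC.
move=> Vtau; set Q := quadform _ _.
have Q0 : 0 <= Q.
  have [L2Sdot _ _] := hfisher _ htheta.
  by rewrite /Q -fisher_quadform//; apply: Rintegral_ge0 => t _; exact: sqr_ge0.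
have [delta delta0 subV] := near_ball_sub hV Vtau.
have [U [nU UTheta cvgU]] := hcons _ htheta.
have cv := @cvg_local_alternative R d u theta tau hu0.
apply/lee_subgt0Pr => e e0.
(* For [rho <= 1], [(1 + rho) (Q + rho) / 2 + 2 rho <= Q / 2 + rho (Q / 2 + 3)], so the total loss
   is at most [e]. *)
pose rho := Num.min 1 (e / (Q / 2 + 3)).
have Q3 : 0 < Q / 2 + 3 by rewrite ltr_wpDl// divr_ge0.
have rho0 : 0 < rho by rewrite lt_min ltr01 divr_gt0.
have rho1 : rho <= 1 by rewrite ge_min lexx.
have rhoe : rho * (Q / 2 + 3) <= e by rewrite -ler_pdivlMr// ge_min lexx orbT.
have near_dist := near_signal_distance_le tau hTheta htheta hS
  (hfisher _ htheta) hu0 rho0.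
have near_U : \forall eps \near 0^'+, U (theta + u eps *: tau) by exact: cv.
have near_M : \forall eps \near 0^'+, 3 / rho ^+ 2 <= (eps^-1 * u eps) ^+ 2.
  (* A threshold of at least 1 that is passed by [eps^-1 * u eps] is passed by its square as
     well. *)
  have K1 : 1 <= 3 / rho ^+ 2.
    have rho2 : rho ^+ 2 <= 1 by rewrite exprn_ile1// ltW.
    by rewrite ler_pdivlMr ?exprn_gt0// mul1r (le_trans rho2)// ler1n.
  have /cvgryPge /(_ (3 / rho ^+ 2)) := huoo.
  apply: filterS => eps leK; rewrite (le_trans leK)// expr2 ler_peMl//.
    by rewrite (le_trans _ leK)// (le_trans _ K1).
  exact: le_trans leK.
(* The alternative [theta + u eps *: tau] moves with [eps], so consistency is used uniformly over
   [U]. *)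
have near_sup : \forall eps \near 0^'+, (ereal_sup [set law P w S eps theta'
    [set y | (delta * u eps < enorm (est eps y - theta'))%R] | theta' in U]
    < (4^-1)%:E)%E.
  have nbhs0 : nbhs (0 : \bar R)%E [set y | (y < (4^-1)%:E)%E].
    apply: open_nbhs_nbhs; split; first exact: open_ereal_lt_ereal.
    by rewrite /= lte_fin invr_gt0.
  exact: (cvgU delta delta0 _ nbhs0).
apply: limf_einf_ge; near=> eps.
have eps0 : 0 < eps by near: eps; exact: nbhs_right_gt.
have u0 := hu _ eps0.
have Ueps : U (theta + u eps *: tau) by near: eps.
have mA : measurable (A eps).
  by apply: measurable_deviation => //; rewrite gt_eqF.
have nuA : ((3 / 4)%:E <= law P w S eps (theta + u eps *: tau) (A eps))%E.
  apply: le_trans (law_deviation_ge hw S hest theta eps0 u0 hV subV).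
  rewrite (_ : 3 / 4 = 1 - 4^-1); last by lra.
  rewrite EFinB leeB// ltW//.
  apply: le_lt_trans (_ : ereal_sup [set law P w S eps theta'
    [set y | (delta * u eps < enorm (est eps y - theta'))%R] | theta' in U]
    < _)%E.
    by apply: ereal_sup_ubound; exists (theta + u eps *: tau).
  by near: eps.
have le_dist : \int[lebesgue_measure]_(t in `[0, 1[)
    (S (theta + u eps *: tau) t - S theta t) ^+ 2 <= u eps ^+ 2 * (Q + rho).
  by near: eps.
have le_M : 3 / rho ^+ 2 <= (eps^-1 * u eps) ^+ 2 by near: eps.
apply: le_trans (lne_law_ge hw eps0 u0 (hS _ htheta) (hS _ (UTheta _ Ueps))
  mA rho0 rho1 le_M le_dist nuA).
rewrite -EFinB lee_fin; nra.
Unshelve. all: by end_near.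
Qed.
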